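(* Let $(X,\tau,\mathfrak a)$ be an aura topological space, with aura topology $\tau_{\mathfrak a}$ and aura reachability preorder $\preccurlyeq_{\mathfrak a}$. Then $$\tau_{\mathfrak a}=\{U\subseteq X:\ \text{for all } x,y\in X,\ x\in U \text{ and } x\preccurlyeq_{\mathfrak a}y \text{ imply } y\in U\},$$ i.e. $\tau_{\mathfrak a}$ is exactly the family of upward-closed subsets (upsets) of $(X,\preccurlyeq_{\mathfrak a})$. Consequently, $\tau_{\mathfrak a}$ is an Alexandrov topology, i.e. it is closed under arbitrary intersections.
   Context: $X$ is a nonempty set. An aura topological space is a triple $(X,\tau,\mathfrak a)$ where $(X,\tau)$ is a topological space and $\mathfrak a:X\to\tau$ (the scope function) satisfies $x\in\mathfrak a(x)$ for every $x\in X$. For $A\subseteq X$ put $\operatorname{int}_{\mathfrak a}(A)=\{x\in A:\mathfrak a(x)\subseteq A\}$. A set $U\subseteq X$ is $\mathfrak a$-open (aura-open) if $\operatorname{int}_{\mathfrak a}(U)=U$; the family of all $\mathfrak a$-open sets is denoted $\tau_{\mathfrak a}$ and is known to be a topology on $X$ with $\tau_{\mathfrak a}\subseteq\tau$. The scope relation is $xR_{\mathfrak a}y\iff y\in\mathfrak a(x)$, and the aura reachability preorder $\preccurlyeq_{\mathfrak a}$ is the reflexive-transitive closure of $R_{\mathfrak a}$. *)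

(* Defs.v *)
From mathcomp Require Import all_boot all_order.
From mathcomp Require Import boolp classical_sets topology.
From Stdlib Require Export Relation_Operators.

Set Implicit Arguments.
Unset Strict Implicit.
Unset Printing Implicit Defensive.

Local Open Scope classical_set_scope.

Record scope_function (X : topologicalType) := ScopeFunction {
  scope :> X -> set X;
  scope_open : forall x, open (scope x);
  scope_mem : forall x, scope x x
}.

Definition aura_interior (X : topologicalType) (a : scope_function X)
    (A : set X) : set X :=
  [set x | A x /\ a x `<=` A].

Definition aura_open (X : topologicalType) (a : scope_function X)
    (U : set X) : Prop :=
  aura_interior a U = U.

Definition aura_topology (X : topologicalType) (a : scope_function X) :
    set (set X) :=
  [set U | aura_open a U].

Definition scope_rel (X : topologicalType) (a : scope_function X)
    (x y : X) : Prop :=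
  a x y.

Definition aura_reach (X : topologicalType) (a : scope_function X) :
    X -> X -> Prop :=
  clos_refl_trans X (scope_rel a).

Definition upsets (X : Type) (R : X -> X -> Prop) : set (set X) :=
  [set U | forall x y, U x -> R x y -> U y].

(* A second topology on the carrier of a topologicalType is given by its
   family of open sets, so as not to clash with the canonical instance. *)
Record is_topology (X : Type) (O : set (set X)) : Prop := IsTopology {
  topology_set0 : O set0;
  topology_setT : O setT;
  topology_setI : forall U V, O U -> O V -> O (U `&` V);
  topology_bigcup : forall F : set (set X), F `<=` O -> O (\bigcup_(U in F) U)
}.

(* For F empty, \bigcap_(U in F) U is the whole space. *)
Definition is_alexandrov_topology (X : Type) (O : set (set X)) : Prop :=
  is_topology O /\
  forall F : set (set X), F `<=` O -> O (\bigcap_(U in F) U).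

(* Main.v *)
Require Import Defs.
From mathcomp Require Import all_boot all_order.
From mathcomp Require Import boolp classical_sets topology.

(** A set [U] is aura-open when each of its points has its whole scope inside
    [U]. Since [y] lies in the scope of [x] exactly when [x] is related to [y],
    this says that [U] is closed under single steps of the scope relation
    ([aura_topologyE]). A set closed under single steps is closed under finite
    chains of steps, so the scope relation and its reflexive-transitive closure
    have the same upsets ([upsets_clos_refl_trans]). The Alexandrov property is
    then a fact about relations: the upsets of any relation are stable under
    arbitrary unions and intersections ([upsets_alexandrov]). *)

Local Open Scope classical_set_scope.

Lemma upsets_clos_refl_trans (X : Type) (R : X -> X -> Prop) :
  upsets (clos_refl_trans X R) = upsets R.
Proof.
apply/seteqP; split=> U UR x y Ux Rxy; first exact: UR Ux (rt_step _ _ _ _ Rxy).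
by elim: Rxy Ux => [u v Ruv Uu|//|u v w _ IHuv _ IHvw /IHuv/IHvw//]; apply: UR Ruv.
Qed.

(** Being an upset constrains one pair of points at a time, through membership
    of a single given point: a step that starts in a member of a union stays in
    that same member, and one that starts in an intersection stays in every
    member. *)
Lemma upsets_alexandrov (X : Type) (R : X -> X -> Prop) :
  is_alexandrov_topology (upsets R).
Proof.
split; last by move=> F FR x y Fx Rxy U FU; exact: FR FU x y (Fx U FU) Rxy.
split=> //.
- by move=> U V UR VR x y [Ux Vx] Rxy; split; [exact: UR Rxy|exact: VR Rxy].
- by move=> F FR x y [U FU Ux] Rxy; exists U => //; exact: FR FU x y Ux Rxy.
Qed.

Lemma aura_topologyE (X : topologicalType) (a : scope_function X) :
  aura_topology a = upsets (scope_rel a).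
Proof.
apply/seteqP; split=> U aU.
  move=> x y Ux axy; move: Ux; rewrite -{1}aU => -[_]; exact.
apply/seteqP; split=> [x []//|x Ux]; split=> // y; exact: aU.
Qed.

Theorem theorem3p1 (X : topologicalType) (X_nonempty : [set: X] !=set0)
    (a : scope_function X) :
  aura_topology a = upsets (aura_reach a) /\
  is_alexandrov_topology (aura_topology a).
Proof.
rewrite /aura_reach upsets_clos_refl_trans aura_topologyE.
by split=> //; exact: upsets_alexandrov.
Qed.
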